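(* Let $\mathcal{R}$ be a ring with unit $1\neq 0$ and with an involution $x\mapsto x^*$. Let $a,b,c,\widetilde{b}\in\mathcal{R}$ be such that $a$ and $c$ are Moore-Penrose invertible, and put $p=a^\dagger abcc^\dagger$ and $q=cc^\dagger \widetilde{b} a^\dagger a$. Then the following conditions are equivalent: (i) $abc$ is Moore-Penrose invertible and $(abc)^{\dagger}=c^{\dagger} \widetilde{b}a^{\dagger}$; (iv) $q\in p\{1\}$, $a^*ap\mathcal{R}\subseteq q^*\mathcal{R}$ and $cc^*p^*\mathcal{R}\supseteq q\mathcal{R}$; (v) $c^\dagger \widetilde{b}a^\dagger$ is left $*$-cancellable, $pq=(pq)^2$, $a^*ap\mathcal{R}\subseteq q^*\mathcal{R}$ and $cc^*p^*\mathcal{R}\supseteq q\mathcal{R}$; (vi) $q\in p\{2\}$, $a^*ap\mathcal{R}\subseteq q^*\mathcal{R}$ and $cc^*p^*\mathcal{R}\supseteq q\mathcal{R}$.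
   Context: $\mathcal{R}$ is a (not necessarily commutative) ring with unit $1\neq 0$ and an involution $x\mapsto x^*$, i.e. $(x^* )^*=x$, $(x+y)^*=x^*+y^*$, $(xy)^*=y^*x^*$ for all $x,y\in\mathcal{R}$. For $x\in\mathcal{R}$, the four Penrose equations for $y\in\mathcal{R}$ are: (1) $xyx=x$; (2) $yxy=y$; (3) $(xy)^*=xy$; (4) $(yx)^*=yx$. The element $x$ is Moore-Penrose invertible if some $y\in\mathcal{R}$ satisfies all four; such $y$ is then unique and denoted $x^\dagger$. For a set of indices, $x\{i,\ldots,j\}$ denotes the set of all $y\in\mathcal{R}$ satisfying equations $(i),\ldots,(j)$; thus $x\{1\}=\{y: xyx=x\}$ and $x\{2\}=\{y: yxy=y\}$. An element $x\in\mathcal{R}$ is left $*$-cancellable if for all $z\in\mathcal{R}$, $x^*xz=0$ implies $xz=0$. For $x\in\mathcal{R}$, $x\mathcal{R}=\{xr: r\in\mathcal{R}\}$. *)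

(* Defs.v *)
From mathcomp Require Import all_boot all_algebra.
From mathcomp Require Import boolp classical_sets.

Set Implicit Arguments.
Unset Strict Implicit.
Unset Printing Implicit Defensive.

Import GRing.Theory.
Local Open Scope classical_set_scope.
Local Open Scope ring_scope.

Definition involution (R : nzRingType) (star : R -> R) : Prop :=
  [/\ forall x, star (star x) = x,
      forall x y, star (x + y) = star x + star y
    & forall x y, star (x * y) = star y * star x].

Section MoorePenrose.
Variables (R : nzRingType) (star : R -> R).
Implicit Types x y z : R.

Definition penrose1 x y : Prop := x * y * x = x.
Definition penrose2 x y : Prop := y * x * y = y.
Definition penrose3 x y : Prop := star (x * y) = x * y.
Definition penrose4 x y : Prop := star (y * x) = y * x.

Definition inverses1 x : set R := [set y | penrose1 x y].
Definition inverses2 x : set R := [set y | penrose2 x y].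

Definition is_mp_inverse x y : Prop :=
  [/\ penrose1 x y, penrose2 x y, penrose3 x y & penrose4 x y].

Definition mp_invertible x : Prop := exists y, is_mp_inverse x y.

(* The Moore-Penrose inverse of x, with the dummy value 0 when x is not
   Moore-Penrose invertible; see dagger_unique for the well-definedness. *)
Definition dagger x : R := xget 0 [set y | is_mp_inverse x y].

Definition left_star_cancellable x : Prop :=
  forall z, star x * x * z = 0 -> x * z = 0.

Definition right_ideal x : set R := [set x * r | r in [set: R]].

Lemma daggerP x : mp_invertible x -> is_mp_inverse x (dagger x).
Proof. by case=> y xy; exact: (xgetPex 0 (ex_intro _ y xy)). Qed.

Hypothesis star_inv : involution star.

Lemma mp_inverse_unique x y z :
  is_mp_inverse x y -> is_mp_inverse x z -> y = z.
Proof.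
case: star_inv => _ _ starM [y1 y2 y3 y4] [z1 z2 z3 z4].
have exy : x * y = x * z.
  rewrite -y3 -{1}z1 -mulrA starM y3 z3 mulrA.
  by rewrite y1.
have eyx : y * x = z * x.
  rewrite -y4 -{1}z1 -(mulrA x) mulrA starM y4 z4.
  by rewrite -mulrA (mulrA x) y1.
by rewrite -y2 -mulrA exy mulrA eyx z2.
Qed.

Lemma dagger_unique x y : is_mp_inverse x y -> dagger x = y.
Proof.
by move=> xy; apply: (@mp_inverse_unique x) => //; apply: daggerP; exists y.
Qed.

End MoorePenrose.

(* Main.v *)
Require Import Defs.
From mathcomp Require Import all_boot all_algebra.
From mathcomp Require Import boolp classical_sets.

Set Implicit Arguments.
Unset Strict Implicit.
Unset Printing Implicit Defensive.

Import GRing.Theory.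
Local Open Scope classical_set_scope.
Local Open Scope ring_scope.

(* Write m = abc, x = c^+ b' a^+, so that m = a p c and x = c^+ q a^+, while
   p = a^+ m c^+ and q = c x a.  The inclusion q R <= c c^* p^* R gives
   x m = (p c)^* v (p c) for some v, which makes x m self-adjoint as soon as
   (p c)(x m) = p c; the inclusion a^* a p R <= q^* R gives
   (a p)^* = (a p)^* m x as soon as q p q = q, which makes m x self-adjoint and
   yields p q p = p at once.  Cancellability of x upgrades
   p (q p q - q) = 0 to q p q = q. *)

Lemma right_ideal_subP (R : nzRingType) (x y : R) :
  right_ideal x `<=` right_ideal y <-> exists u, x = y * u.
Proof.
split=> [sxy | [u ->] _ [r _ <-]].
  by have [|u _ yu] := sxy x; [exists 1; rewrite ?mulr1 | exists u].
by exists (u * r); rewrite ?mulrA.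
Qed.

Section ReducedProduct.
Variables (R : nzRingType) (star : R -> R).
Hypothesis star_inv : involution star.
Variables a a' c c' p q : R.
Hypothesis aa' : is_mp_inverse star a a'.
Hypothesis cc' : is_mp_inverse star c c'.
(** These four absorption laws are all that is kept of the formulas for [p] and [q], so the section
    never mentions [b] and [b']. *)
Hypothesis a'ap : a' * a * p = p.
Hypothesis pcc' : p * c * c' = p.
Hypothesis cc'q : c * c' * q = q.
Hypothesis qa'a : q * a' * a = q.

Let starK x : star (star x) = x. Proof. by case: star_inv. Qed.
Let starM x y : star (x * y) = star y * star x. Proof. by case: star_inv. Qed.
Let ap_l t : a' * (a * (p * t)) = p * t. Proof. by rewrite !mulrA a'ap. Qed.
Let cq_l t : c * (c' * (q * t)) = q * t. Proof. by rewrite !mulrA cc'q. Qed.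
Let pc_r : p * (c * c') = p. Proof. by rewrite mulrA. Qed.
Let qa_r : q * (a' * a) = q. Proof. by rewrite mulrA. Qed.
Let pc_l t : p * (c * (c' * t)) = p * t. Proof. by rewrite !mulrA pcc'. Qed.
Let qa_l t : q * (a' * (a * t)) = q * t. Proof. by rewrite !mulrA qa'a. Qed.
Let ap : a' * (a * p) = p. Proof. by rewrite mulrA. Qed.
Let cq : c * (c' * q) = q. Proof. by rewrite mulrA. Qed.
(** Meant for right-associated products: the [_l] forms act when a tail follows, the others at the
    end of a product. *)
Let absorbE := (ap_l, cq_l, pc_l, qa_l, ap, cq, pc_r, qa_r).

Let star_sq x : star (star x * x) = star x * x.
Proof. by rewrite starM starK. Qed.
Let star_q : star a * (star a' * star q) = star q.
Proof. by rewrite -!starM qa'a. Qed.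
Let star_p : star c' * (star c * star p) = star p.
Proof. by rewrite -!starM pcc'. Qed.
Let star_pa : star p * star a * star a' = star p.
Proof. by rewrite -mulrA -!starM a'ap. Qed.
Let star_c : c' * c * star c = star c.
Proof. by case: cc' => c1 _ _ <-; rewrite -starM mulrA c1. Qed.

Let mxE : a * p * c * (c' * q * a') = a * p * q * a'.
Proof. by rewrite -!mulrA absorbE. Qed.
Let xmE : c' * q * a' * (a * p * c) = c' * q * p * c.
Proof. by rewrite -!mulrA absorbE. Qed.

Lemma inverses1_of_mp_inverse :
  is_mp_inverse star (a * p * c) (c' * q * a') -> inverses1 p q.
Proof.
case=> + _ _ _; rewrite /penrose1 mxE => /(congr1 (fun z => a' * z * c')).
by rewrite -!mulrA !absorbE mulrA.
Qed.

Lemma inverses2_of_mp_inverse :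
  is_mp_inverse star (a * p * c) (c' * q * a') -> inverses2 p q.
Proof.
case=> _ + _ _; rewrite /penrose2 xmE => /(congr1 (fun z => c * z * a)).
by rewrite -!mulrA !absorbE mulrA.
Qed.

Lemma left_inclusion_of_mp_inverse :
  is_mp_inverse star (a * p * c) (c' * q * a') ->
  right_ideal (star a * a * p) `<=` right_ideal (star q).
Proof.
move=> mx; have pqp := inverses1_of_mp_inverse mx.
case: mx => _ _ + _; rewrite /penrose3 mxE => m3; apply/right_ideal_subP.
(* Since a p = (m x)^* a p and a^* (m x)^* = (a p q)^* = q^* p^* a^*, the factor after q^* can be
   read off. *)
exists (star p * star a * a * p).
have eap : a * p = star (a * p * q * a') * (a * p).
  by rewrite m3 -!mulrA ap [p * (q * p)]mulrA pqp.
by rewrite -mulrA {1}eap !starM -!mulrA !(mulrA (star a) (star a')) !mulrA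
  -(mulrA (star a)) star_q.
Qed.

Lemma right_inclusion_of_mp_inverse :
  is_mp_inverse star (a * p * c) (c' * q * a') ->
  right_ideal q `<=` right_ideal (c * star c * star p).
Proof.
move=> mx; have qpq := inverses2_of_mp_inverse mx.
case: mx => _ _ _ +; rewrite /penrose4 xmE => m4; apply/right_ideal_subP.
(* Read off from q = c (x m)^* c' q by expanding the adjoint of x m = c' q p c. *)
exists (star q * star c' * c' * q).
have : c * star (c' * q * p * c) * (c' * q) = q.
  by rewrite m4 -!mulrA !absorbE mulrA qpq.
by rewrite !starM !mulrA.
Qed.

(** The hypotheses amount to x = m^* x^* x, so x^* x z = 0 forces x z = 0. Below, [lE] computes p^*
    a^* x^* x z, and a further factor c^* restores x z. *)
Lemma left_star_cancellable_of_inverses1 :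
  inverses1 p q -> right_ideal q `<=` right_ideal (c * star c * star p) ->
  left_star_cancellable star (c' * q * a').
Proof.
rewrite /inverses1 /= /penrose1 => pqp /right_ideal_subP [v qE] z.
have c'qE : c' * q = star c * star p * v by rewrite qE !mulrA star_c.
have spqp : star p * (star q * star p) = star p by rewrite -!starM pqp.
have lE : star p * star a * (star (c' * q * a') * (c' * q * a' * z))
    = star p * (v * (a' * z)).
  rewrite !starM !mulrA star_pa -(mulrA _ c' q) c'qE -!mulrA.
  by rewrite !(mulrA (star c)) (mulrA (star c')) star_p !mulrA -(mulrA (star p)) spqp.
rewrite -mulrA => /(congr1 (fun t => star p * star a * t)).
rewrite mulr0 lE => /(congr1 (fun t => star c * t)).
by rewrite mulr0 c'qE !mulrA.
Qed.

Lemma inverses2_of_left_star_cancellable :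
  left_star_cancellable star (c' * q * a') -> p * q = (p * q) ^+ 2 ->
  right_ideal q `<=` right_ideal (c * star c * star p) -> inverses2 p q.
Proof.
move=> canc pq2 /right_ideal_subP [v qE].
have sqc : star q * star c' = star v * (p * c).
  by rewrite -starM qE !mulrA star_c !starM !starK mulrA.
have pw : p * (q * (p * q - 1)) = 0.
  by rewrite mulrA mulrBr mulr1 -expr2 -pq2 subrr.
have xE : c' * q * a' * (a * (p * q - 1)) = c' * (q * (p * q - 1)).
  by rewrite -!mulrA absorbE.
(* Cancellation is applied to z = a (p q - 1): here x z = c' (q p q - q), and x^* contains a factor
   p c, which kills it because p (q p q - q) = 0. *)
have /canc : star (c' * q * a') * (c' * q * a') * (a * (p * q - 1)) = 0.
  by rewrite -mulrA xE !starM sqc -!mulrA pc_l pw !mulr0.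
rewrite xE => /(congr1 (fun t => c * t)).
by rewrite mulr0 cq_l mulrBr mulr1 mulrA => /subr0_eq.
Qed.

Lemma mp_inverse_of_inverses2 :
  inverses2 p q ->
  right_ideal (star a * a * p) `<=` right_ideal (star q) ->
  right_ideal q `<=` right_ideal (c * star c * star p) ->
  is_mp_inverse star (a * p * c) (c' * q * a').
Proof.
rewrite /inverses2 /= /penrose2.
move=> qpq /right_ideal_subP [u apE] /right_ideal_subP [v qE].
(* The inclusion gives p^* a^* a = u^* q, which is fixed by right multiplication by p q because q p
   q = q; then a^* a a' = a^*. *)
have sap : star (a * p) * (a * p * q * a') = star (a * p).
  have e : star p * star a * a = star u * q.
    by rewrite -[RHS]starK starM starK -apE !starM starK mulrA.
  have {}e : star p * star a * a * p * q = star p * star a * a.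
    by rewrite e -!mulrA [q * _]mulrA qpq.
  rewrite starM !mulrA e -!mulrA; case: aa' => a1 _ a3 _.
  by rewrite -a3 -!starM a1.
(* Here (m x)^* (m x) = (m x)^*, and the left side is self-adjoint. *)
have m3 : star (a * p * q * a') = a * p * q * a'.
  have e : star (a * p * q * a') * (a * p * q * a') = star (a * p * q * a').
    by rewrite -{1 3}(mulrA (a * p)) starM -mulrA sap.
  by have := star_sq (a * p * q * a'); rewrite e starK.
(* The adjoint of [sap] reads m x a p = a p; multiplying by [a'] on the left removes [a]. *)
have pqp : p * q * p = p.
  have := congr1 star sap; rewrite starM m3 starK => /(congr1 (fun t => a' * t)).
  by rewrite -!mulrA !absorbE.
have f4 : star (c' * q * p * c) = c' * q * p * c.
  have fE : c' * q * p * c = star (p * c) * v * (p * c).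
    by rewrite qE !mulrA star_c starM.
  (* As x m = (p c)^* v (p c) and p c x m = p q p c = p c, the factor (x m)^* is absorbed into (p
     c)^*. *)
  have e : star (c' * q * p * c) * (c' * q * p * c) = c' * q * p * c.
    rewrite {2 3}fE !mulrA -starM.
    by rewrite -!mulrA !absorbE !mulrA pqp.
  by have := star_sq (c' * q * p * c); rewrite e.
split; rewrite /penrose1 /penrose2 /penrose3 /penrose4 ?mxE ?xmE //.
- by rewrite -!mulrA !absorbE [p * (q * _)]mulrA [_ * (p * _)]mulrA pqp.
- by rewrite -!mulrA !absorbE [q * (p * _)]mulrA [_ * (q * _)]mulrA qpq.
Qed.

End ReducedProduct.

Theorem theorem2p4 (R : nzRingType) (star : R -> R)
    (star_inv : involution star) (a b c b' : R)
    (a_mp : mp_invertible star a) (c_mp : mp_invertible star c) :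
  let p := dagger star a * a * b * c * dagger star c in
  let q := c * dagger star c * b' * dagger star a * a in
  [<->
    mp_invertible star (a * b * c) /\
      dagger star (a * b * c) = dagger star c * b' * dagger star a;

    [/\ inverses1 p q,
        right_ideal (star a * a * p) `<=` right_ideal (star q)
      & right_ideal q `<=` right_ideal (c * star c * star p)];

    [/\ left_star_cancellable star (dagger star c * b' * dagger star a),
        p * q = (p * q) ^+ 2,
        right_ideal (star a * a * p) `<=` right_ideal (star q)
      & right_ideal q `<=` right_ideal (c * star c * star p)];

    [/\ inverses2 p q,
        right_ideal (star a * a * p) `<=` right_ideal (star q)
      & right_ideal q `<=` right_ideal (c * star c * star p)]].
Proof.
move=> p q.
have aa' := daggerP a_mp; have cc' := daggerP c_mp.
(* From here on, only the Penrose equations of the two inverses matter. *)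
move: (dagger star a) (dagger star c) aa' cc' @p @q => a' c' aa' cc' p q.
have [a1 a2 _ _] := aa'; have [c1 c2 _ _] := cc'.
have a'ap : a' * a * p = p by rewrite /p !mulrA a2.
have pcc' : p * c * c' = p by rewrite /p -!mulrA (mulrA c') c2.
have cc'q : c * c' * q = q by rewrite /q !mulrA c1.
have qa'a : q * a' * a = q by rewrite /q -!mulrA (mulrA a a') a1.
have mE : a * b * c = a * p * c by rewrite /p !mulrA a1 -!mulrA (mulrA c) c1.
have xE : c' * b' * a' = c' * q * a' by rewrite /q !mulrA c2 -!mulrA (mulrA a') a2.
rewrite mE xE; tfae.
- case=> /daggerP + mx; rewrite mx => {}mx; split.
  + exact: (inverses1_of_mp_inverse a'ap pcc' qa'a mx).
  + exact: (left_inclusion_of_mp_inverse star_inv a'ap pcc' qa'a mx).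
  + exact: (right_inclusion_of_mp_inverse star_inv pcc' cc'q qa'a mx).
- case=> pqp sp sq; split=> //.
    exact: (left_star_cancellable_of_inverses1 star_inv cc' a'ap pcc' pqp sq).
  by rewrite expr2 mulrA pqp.
- case=> canc pq2 sp sq; split=> //.
  exact: (inverses2_of_left_star_cancellable star_inv cc' pcc' cc'q qa'a canc pq2 sq).
- case=> qpq sp sq.
  have mx : is_mp_inverse star (a * p * c) (c' * q * a').
    exact: (mp_inverse_of_inverses2 star_inv aa' cc' a'ap pcc' qa'a qpq sp sq).
  by split; [exists (c' * q * a') | apply: dagger_unique mx].
Qed.
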